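(* Let $\{X_t,Z_t\}$ be a mean-zero jointly stationary bivariate time series with residual spectral density $f=f_{X|Z}=f_X-f_{XZ}f_{ZX}/f_Z$, and let $\tilde f=f/\langle f\rangle_\pi$ and $F(\lambda)=\int_0^\lambda\tilde f(\omega)d\omega$. Let $R\in\mathcal{R}_L$ with Lipschitz constant $L_R$, and let $\delta>0$ be such that $$S:=\sup_{0\le\lambda\le\pi}|\pi\tilde f(\lambda)-1|>\frac{\sqrt\delta}{L_R\pi}.$$ For $\Delta>0$ let $h(\lambda)=A(\tilde f(\lambda)+\Delta)$ with $A=\langle f\rangle_\pi/(1+\pi\Delta)$, $H(\lambda)=\int_0^\lambda\tilde h(t)dt$ where $\tilde h=h/\langle h\rangle_\pi$, and let the released data be based on the privacy mechanism $\Psi_h(e^{-i\lambda})=\exp\{i\pi\tilde R(H(\lambda))\}$, where $\tilde R(x)=\mathrm{sgn}(x)R(|x|)$. Then $\Psi_h$ is $\delta$-LIP if $\Delta\in(0,B]$, where $$B=\sqrt\delta\,\big(L_R\pi^2S-\pi\sqrt\delta\big)^{-1}.$$ Moreover, if $R$ has a derivative $r$ with $r(x)>0$ for all $x\in(0,1)$, and $f(\lambda)>0$ for $0\le\lambda\le\pi$, then for every $0<\lambda<\pi$, $$|\Psi_h(e^{-i\lambda})-\Psi_f(e^{-i\lambda})|\ge\frac{\alpha\pi}{2}Q(\lambda)\,|F(\lambda)-\lambda/\pi|,$$ where $\Psi_f(e^{-i\lambda})=\exp\{i\pi\tilde R(F(\lambda))\}$, $\alpha=\Delta\pi/(1+\Delta\pi)$,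 $Q(\lambda)=\min_{x\in L(\lambda)}r(x)$, and $L(\lambda)$ is the closed line segment joining $F(\lambda)$ and $(1-\alpha)F(\lambda)+\alpha\lambda/\pi$.
   Context: Spectral densities are even functions on $[-\pi,\pi]$. Notation: $\langle u,f\rangle=(2\pi)^{-1}\int_{-\pi}^{\pi}u(\lambda)f(\lambda)d\lambda$, $\langle f\rangle=\langle1,f\rangle$, $\langle f\rangle_\pi=\pi^{-1}\int_0^\pi f(\lambda)d\lambda$. Classes: $\mathcal{R}=\{R:[0,1]\to[0,1]:R(0)=0,\ R(x)+R(1-x)=1\ \forall x\}$ and $\mathcal{R}_L=\{R\in\mathcal{R}:|R(x)-R(y)|\le L_R|x-y|\ \forall x,y\in[0,1]\}$, $L_R>0$. For a linear filter $\Psi$ (evaluated at $e^{-i\lambda}$, with $\overline{\Psi(e^{-i\lambda})}=\Psi(e^{i\lambda})$), the Linear Incremental Privacy is $\mathrm{LIP}(\Psi,f)=1-\langle\Psi,f\rangle^2/(\langle\Psi\overline\Psi,f\rangle\langle f\rangle)$, which for an all-pass filter ($|\Psi(e^{-i\lambda})|=1$) equals $1-\langle\Psi,f\rangle^2/\langle f\rangle^2$. $\Psi$ is $\delta$-LIP for $f$ if $\mathrm{LIP}(\Psi,f)\ge1-\delta$.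
   Formalization: The normalized densities are f̃=f/∫₀^π f and h̃=h/∫₀^π h, not f/⟨f⟩_π and h/⟨h⟩_π with ⟨f⟩_π=π⁻¹∫₀^π f; the latter would give F(π)=π>1, outside the domain [0,1] of R, leaving Ψ_f and Ψ_h undefined. *)

(* Defs.v *)
(* mathcomp-analysis (Lebesgue integral on R) + real_closed complex numbers R[i]. *)
From HB Require Import structures.
From mathcomp Require Import all_boot all_order all_algebra.
From mathcomp Require Import all_classical all_reals all_analysis.
From mathcomp Require Import complex.
Set Implicit Arguments. Unset Strict Implicit. Unset Printing Implicit Defensive.
Import Order.TTheory GRing.Theory Num.Theory.
Import numFieldNormedType.Exports.
Local Open Scope classical_set_scope.
Local Open Scope ring_scope.
Local Open Scope complex_scope.

Section Defs.
Variable R : realType.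
Notation mu := (@lebesgue_measure R).

(* Lebesgue integral of g over the interval [a,b] (real valued) *)
Definition Iab (g : R -> R) (a b : R) : R := \int[mu]_(x in `[a, b]) g x.

(* oriented integral  int_0^l g *)
Definition I0 (g : R -> R) (l : R) : R :=
  if 0 <= l then Iab g 0 l else - Iab g l 0.

(* e^{i theta} *)
Definition cexp (t : R) : R[i] := (cos t) +i* (sin t).

(* <u, f> = (2 pi)^-1 int_{-pi}^{pi} u f, for complex u and real f *)
Definition pairing (u : R -> R[i]) (f : R -> R) : R[i] :=
  ((2 * pi)^-1 * Iab (fun x => complex.Re (u x) * f x) (- pi) pi)
  +i* ((2 * pi)^-1 * Iab (fun x => complex.Im (u x) * f x) (- pi) pi).

Definition cmean (f : R -> R) : R[i] := pairing (fun _ => 1) f.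

(* Linear Incremental Privacy; Psi is given as the function lambda |-> Psi(e^{-i lambda}) *)
Definition LIP (Psi : R -> R[i]) (f : R -> R) : R[i] :=
  1 - (pairing Psi f) ^+ 2
      / (pairing (fun x => Psi x * (Psi x)^*) f * cmean f).

Definition is_deltaLIP (delta : R) (Psi : R -> R[i]) (f : R -> R) : Prop :=
  ((1 - delta) +i* 0) <= LIP Psi f.

(* the class R_L with Lipschitz constant LR *)
Definition in_RL (Rf : R -> R) (LR : R) : Prop :=
  [/\ 0 < LR,
      (forall x, 0 <= x <= 1 -> 0 <= Rf x <= 1),
      Rf 0 = 0,
      (forall x, 0 <= x <= 1 -> Rf x + Rf (1 - x) = 1)
    & (forall x y, 0 <= x <= 1 -> 0 <= y <= 1 -> `|Rf x - Rf y| <= LR * `|x - y|)].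

(* R~(x) = sgn(x) R(|x|) *)
Definition Rtilde (Rf : R -> R) (x : R) : R := Num.sg x * Rf `|x|.

(* normalised density: g~ = g / int_0^pi g  (so that int_0^pi g~ = 1) *)
Definition normd (g : R -> R) : R -> R := fun x => g x / Iab g 0 pi.

(* cumulative function  l |-> int_0^l g~ *)
Definition cumul (g : R -> R) : R -> R := I0 (normd g).

(* privacy mechanism  Psi_g(e^{-i l}) = exp{ i pi R~(G(l)) } *)
Definition Psi_mech (Rf : R -> R) (g : R -> R) : R -> R[i] :=
  fun l => cexp (pi * Rtilde Rf (cumul g l)).

(* S = sup_{0<=l<=pi} |pi f~(l) - 1|, as an extended real *)
Definition Ssup (f : R -> R) : \bar R :=
  ereal_sup [set (`|pi * normd f l - 1|)%:E | l in `[0, pi]].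

(* B = sqrt delta (LR pi^2 S - pi sqrt delta)^-1, with B = 0 when S = +oo *)
Definition Bconst (f : R -> R) (LR delta : R) : R :=
  match Ssup f with
  | r%:E => Num.sqrt delta / (LR * pi ^+ 2 * r - pi * Num.sqrt delta)
  | _ => 0
  end.

(* h = A (f~ + Delta),  A = <f>_pi / (1 + pi Delta) *)
Definition hfun (f : R -> R) (Delta : R) : R -> R :=
  let A := (pi^-1 * Iab f 0 pi) / (1 + pi * Delta) in
  fun l => A * (normd f l + Delta).

(* Q(l) = min over the segment joining a and b of r (taken as an infimum) *)
Definition Qmin (r : R -> R) (a b : R) : R :=
  inf [set r x | x in [set x | Num.min a b <= x <= Num.max a b]].

End Defs.

(* Main.v *)
(** Privacy bound: the image of the measure with density h~ under its own
    cumulative function H is uniform on [0, 1], and R(x) + R(1 - x) = 1 makes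
    cos (pi R) antisymmetric about 1/2, so int_0^pi cos (pi R(H)) h~ = 0.
    Hence int_0^pi cos (pi R(H)) f~ = int_0^pi cos (pi R(H)) (f~ - h~), which
    is at most Delta pi S / (1 + pi Delta) in absolute value because
    f~ - h~ = Delta (pi f~ - 1) / (1 + pi Delta); the sine part vanishes by
    parity.  Since L_R >= R(1) - R(0) = 1, the condition on Delta is more than
    enough.

    Lower bound: H - F = alpha (l / pi - F), the mean value theorem gives
    |R(H) - R(F)| >= Q |H - F|, and a chord of the unit circle is at least half
    of its arc when the arc is at most pi. *)
Require Import Defs.
From HB Require Import structures.
From mathcomp Require Import all_boot all_order all_algebra.
From mathcomp Require Import all_classical all_reals all_analysis.
From mathcomp Require Import measurable_realfun complex ring lra.
Import Order.TTheory GRing.Theory Num.Theory.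
Import numFieldNormedType.Exports.
Local Open Scope classical_set_scope.
Local Open Scope ring_scope.
Local Open Scope complex_scope.

(** * Integrals over compact intervals: positivity, domination, reflection and parity *)

Section IntervalIntegrals.
Context {R : realType}.
Notation mu := (@lebesgue_measure R).
Implicit Types (g p : R -> R) (a b : R).

Lemma integrable_sub_itv {g a b c d} : a <= c -> d <= b ->
  mu.-integrable `[a, b] (EFin \o g) -> mu.-integrable `[c, d] (EFin \o g).
Proof.
move=> ac db; apply: integrableS => //.
by apply: subset_itv; rewrite bnd_simp.
Qed.

Lemma IabD {g a b c} : a <= b <= c -> mu.-integrable `[a, c] (EFin \o g) ->
  Iab g a c = Iab g a b + Iab g b c.
Proof.
move=> /andP[ab bc] ig.
have := @Rintegral_itvB R g (BLeft a) (BRight c) b ig.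
rewrite !bnd_simp ab bc => /(_ isT isT) /eqP; rewrite subr_eq => /eqP.
rewrite Rintegral_itv_obnd_cbnd; last first.
  by apply: integrableS ig => //; apply: subset_itvr; rewrite bnd_simp.
by rewrite /Iab addrC.
Qed.

Lemma IabZ {g a b} c : mu.-integrable `[a, b] (EFin \o g) ->
  Iab (fun x => c * g x) a b = c * Iab g a b.
Proof. by move=> ig; rewrite /Iab RintegralZl. Qed.

Lemma eq_Iab {g p a b} : (forall x, a <= x <= b -> g x = p x) ->
  Iab g a b = Iab p a b.
Proof.
by move=> gp; apply: eq_Rintegral => x; rewrite inE /= in_itv /=; exact: gp.
Qed.

Lemma Iab_cst a b c : a <= b -> Iab (fun=> c) a b = c * (b - a).
Proof.
move=> ab; rewrite /Iab Rintegral_cst//= lebesgue_measure_itv /= lte_fin.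
by case: ltgtP ab => //= -> _; rewrite subrr.
Qed.

Lemma integrable_cst_itv a b c : mu.-integrable `[a, b] (EFin \o (fun=> c)).
Proof.
apply: continuous_compact_integrable; first exact: segment_compact.
by apply: continuous_subspaceT => x; exact: cvg_cst.
Qed.

Lemma Iab_ge0 {g a b} : (forall x, a <= x <= b -> 0 <= g x) -> 0 <= Iab g a b.
Proof. by move=> g0; apply: Rintegral_ge0 => x /=; rewrite in_itv /=; exact: g0. Qed.

(** A nonnegative integrand with zero integral vanishes almost everywhere; here it vanishes nowhere
    on the interval, which would then be a null set of positive length. *)
Lemma Iab_gt0 {g a b} : a < b -> (forall x, a <= x <= b -> 0 < g x) ->
  mu.-integrable `[a, b] (EFin \o g) -> 0 < Iab g a b.
Proof.
move=> ab g0 ig.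
rewrite lt_neqAle Iab_ge0 ?andbT; last by move=> x /g0/ltW.
apply/negP => /eqP /esym I0.
have : (\int[mu]_(x in `[a, b]) (EFin \o g) x = 0)%E.
  have := integrable_fin_num _ ig => /(_ (measurable_itv _))/fineK <-.
  by rewrite -[fine _]/(Iab g a b) I0.
have E : (\int[mu]_(x in `[a, b]) `|(EFin \o g) x| =
          \int[mu]_(x in `[a, b]) (EFin \o g) x)%E.
  apply: eq_integral => x; rewrite inE /= in_itv /= => /g0 gx.
  by rewrite gtr0_norm.
rewrite -E => /(@ae_eq_integral_abs _ _ _ mu).
move=> /(_ (measurable_itv _) (measurable_int _ ig)) [N [mN N0 sN]].
(* The exceptional null set [N] contains every point where [g] is nonzero, hence the whole
   interval. *)
have : (mu `[a, b] <= mu N)%E.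
  apply: le_measure; rewrite ?inE//.
  move=> x /= xab; apply: sN => /= /(_ xab) [] gx.
  by move: xab; rewrite in_itv /= => /g0; rewrite gx ltxx.
by rewrite N0 lebesgue_measure_itv /= lte_fin ab -EFinD lee_fin leNgt subr_gt0 ab.
Qed.

Lemma le_norm_Iab {g p a b} : mu.-integrable `[a, b] (EFin \o g) ->
  mu.-integrable `[a, b] (EFin \o p) ->
  (forall x, a <= x <= b -> `|g x| <= p x) -> `|Iab g a b| <= Iab p a b.
Proof.
move=> ig ip gp; apply: (le_trans (le_normr_Rintegral _ ig)) => //.
apply: le_Rintegral => //; exact: integrable_norm.
Qed.

Lemma lipschitz_comp_continuous (A : set R) (u v : R -> R) (K : R) :
  {within A, continuous u} ->
  (forall x y, A x -> A y -> `|v x - v y| <= K * `|u x - u y|) ->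
  {within A, continuous v}.
Proof.
move=> cu uv; apply/subspace_continuousP => x Ax.
move/subspace_continuousP : cu => /(_ x Ax) cu.
apply/cvgrPdist_le => e e0.
(* [K] may be zero or negative, so it is enlarged before dividing by it. *)
pose k := Num.max K 1.
have k0 : 0 < k by rewrite /k lt_max ltr01 orbT.
move/cvgrPdist_le : cu => /(_ (e / k)); rewrite divr_gt0// => /(_ isT).
rewrite /within /prop_near1 /= !nbhs_simpl/=; apply: filterS => y + Ay => /(_ Ay) H.
apply: (le_trans (uv _ _ Ax Ay)); apply: (@le_trans _ _ (k * `|u x - u y|)).
  by apply: ler_wpM2r => //; rewrite /k le_max lexx.
by rewrite mulrC -ler_pdivlMr.
Qed.

(** Continuity of [v] gives measurability, and the product is dominated by [M * g]. *)
Lemma integrableM_bounded {g} {v : R -> R} {a b} (M : R) : {within `[a, b], continuous v} ->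
  (forall x, a <= x <= b -> `|v x| <= M) ->
  mu.-integrable `[a, b] (EFin \o g) ->
  mu.-integrable `[a, b] (EFin \o (fun x => v x * g x)).
Proof.
move=> cv vM ig.
apply: le_integrable (integrableZl _ M ig) => //.
- apply/measurable_EFinP; apply: measurable_funM.
    exact: subspace_continuous_measurable_fun.
  by apply/measurable_EFinP; exact: (measurable_int _ ig).
- move=> x /=; rewrite in_itv /= => /vM h.
  rewrite lee_fin !normrM; apply: ler_wpM2r => //.
  exact: (le_trans h (ler_norm _)).
Qed.

(** Change of variable [x -> - x]: the pushforward of Lebesgue measure under negation is Lebesgue
    measure again. *)
Lemma Iab_opp {g b} : mu.-integrable `[0, b] (EFin \o g) ->
  mu.-integrable `[- b, 0] (EFin \o (fun x => g (- x))) /\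
  Iab (fun x => g (- x)) (- b) 0 = Iab g 0 b.
Proof.
(* The pushforward theorem is applied to a function measurable on the whole line, so [g] is first
   extended by zero. *)
move=> ig; pose g' := g \_ `[0, b].
have ig' : mu.-integrable `[0, b] (EFin \o g').
  apply: eq_integrable ig => // x xb.
  by rewrite /= /g' patchE xb.
have mg' : measurable_fun [set: measurableTypeR R] (EFin \o (fun x => g' (- x))).
  apply/measurable_EFinP; apply: (measurableT_comp (f := g')) => //.
  by apply/(measurable_restrictT _ _).1 => //; apply/measurable_EFinP;
     exact: (measurable_int _ ig).
pose opp : measurableTypeR R -> measurableTypeR R := -%R.
have pre : opp @^-1` `[- b, 0]%classic = `[0, b]%classic.
  by apply/seteqP; split => x /=; rewrite !in_itv /= lerN2 oppr_le0 andbC.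
have E : (EFin \o (fun x => g' (- x))) \o opp = EFin \o g'.
  by apply/funext => x /=; rewrite /opp opprK.
have ig2 : mu.-integrable (opp @^-1` `[- b, 0]%classic) ((EFin \o (fun x => g' (- x))) \o opp).
  by rewrite E pre.
have mo : measurable_fun [set: measurableTypeR R] opp by exact: oppr_measurable.
have eqg x : x \in `[- b, 0]%classic -> g' (- x) = g (- x).
  rewrite inE /= in_itv /= => H.
  rewrite /g' patchE ifT // inE /= in_itv /=; lra.
split.
  apply: eq_integrable (_ : mu.-integrable _ (EFin \o (fun x => g' (- x)))) => //.
    by move=> x /eqg /= ->.
  have /integrableP[_ H] := integrable_pushforward mo mg' ig2 (measurable_itv _).
  apply/integrableP; split; first exact: measurable_funTS.
  apply: le_lt_trans H; rewrite le_eqVlt; apply/orP; left; apply/eqP.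
  by apply: eq_measure_integral => A mA _; exact/esym/lebesgue_measureN.
have := integral_pushforward mo mg' ig2 (measurable_itv _).
rewrite E pre /Iab /Rintegral => H; congr fine.
transitivity (integral mu `[0, b]%classic (EFin \o g')); last first.
  by apply: eq_integral => x xb; rewrite /= /g' patchE xb.
rewrite -H.
transitivity (integral mu `[- b, 0]%classic (EFin \o (fun x => g' (- x)))).
  by apply: eq_integral => x xb; rewrite /= eqg.
by apply: eq_measure_integral => A mA _; exact/esym/lebesgue_measureN.
Qed.

(** Covers even functions with [s = 1] and odd ones with [s = -1]: reflection turns the integral
    over the negative half into [s] times the one over the positive half. *)
Lemma Iab_sym {g b} (s : R) : 0 <= b -> mu.-integrable `[0, b] (EFin \o g) ->
  (forall x, 0 <= x <= b -> g (- x) = s * g x) ->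
  Iab g (- b) b = (1 + s) * Iab g 0 b.
Proof.
move=> b0 ig gs; have [ig' Ig'] := Iab_opp ig.
have gE x : - b <= x <= 0 -> g x = s * g (- x).
  by move=> xb; have := gs (- x); rewrite opprK; apply; lra.
have isg : mu.-integrable `[- b, 0] (EFin \o g).
  apply: eq_integrable (integrableZl _ s ig') => //.
  by move=> x; rewrite inE /= in_itv /= => /gE ->; rewrite EFinM.
have int : mu.-integrable `[- b, b] (EFin \o g).
  (* Cutting with the half-open []0, b]] makes the two pieces disjoint, so the integral of the norm
     is additive over them. *)
  rewrite (@itv_bndbnd_setU _ _ _ (BRight 0)) ?bnd_simp; [|lra|lra].
  have ig0 : mu.-integrable `]0, b] (EFin \o g).
    by apply: integrableS ig => //; apply: subset_itvr; rewrite bnd_simp.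
  have mg : measurable_fun (`[- b, 0]%classic `|` `]0, b]%classic
      : set (measurableTypeR R)) (EFin \o g).
    by apply/measurable_funU => //; split;
      [exact: (measurable_int _ isg)|exact: (measurable_int _ ig0)].
  apply/integrableP; split => //.
  rewrite ge0_integral_setU //.
  - by apply: lte_add_pinfty; [case/integrableP: isg|case/integrableP: ig0].
  - exact: (measurableT_comp _ mg).
  - rewrite /disj_set; apply/eqP/seteqP; split => y //= [].
    by rewrite !in_itv /= => /andP[_ yx] /andP[]; rewrite ltNge yx.
rewrite (@IabD _ _ 0) //; last by lra.
rewrite mulrDl mul1r addrC; congr (_ + _).
by rewrite (eq_Iab gE) IabZ // Ig'.
Qed.

End IntervalIntegrals.

(** * Uniformity of a density under its own cumulative function, by Riemann sums *)

Section Substitution.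
#[local] Set Implicit Arguments.
#[local] Unset Strict Implicit.
Context {R : realType}.
Notation mu := (@lebesgue_measure R).

Lemma Iab_weighted_near_cst (v p : R -> R) (a b c e : R) :
  mu.-integrable `[a, b] (EFin \o p) ->
  mu.-integrable `[a, b] (EFin \o (fun x => v x * p x)) ->
  (forall x, a <= x <= b -> 0 <= p x) ->
  (forall x, a <= x <= b -> `|v x - c| <= e) ->
  `|Iab (fun x => v x * p x) a b - c * Iab p a b| <= e * Iab p a b.
Proof.
move=> ip ivp p0 ve.
have icp : mu.-integrable `[a, b] (EFin \o (fun x => c * p x)).
  exact: (integrableZl _ c ip).
rewrite -(IabZ c ip) -(IabZ e ip) /Iab -RintegralB //.
apply: le_norm_Iab.
- exact: (integrableB _ ivp icp).
- exact: (integrableZl _ e ip).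
move=> x xab; rewrite -mulrBl normrM (ger0_norm (p0 _ xab)).
by apply: ler_wpM2r; [exact: p0|exact: ve].
Qed.

(** The reversal [j -> n - 1 - j] sends each midpoint [x] to [1 - x], so the sum equals its own
    opposite. *)
Lemma midpoint_sum_antisym (g : R -> R) (n : nat) : (0 < n)%N ->
  (forall x, 0 <= x <= 1 -> g (1 - x) = - g x) ->
  \sum_(j < n) g ((j%:R + 2^-1) / n%:R) = 0.
Proof.
move=> n0 gN; set S := \sum_(j < n) _.
have nR : 0 < n%:R :> R by rewrite ltr0n.
have E : S = - S.
  rewrite {1}/S (reindex_inj rev_ord_inj) /= /S -sumrN; apply: eq_bigr => j _.
  rewrite -gN.
    congr g; rewrite natrB // -natr1 mulrDl mulrBl divff ?gt_eqF //; lra.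
  have jn : j%:R + 1 <= n%:R :> R by rewrite natr1 ler_nat.
  have j0 : 0 <= j%:R :> R by [].
  by apply/andP; split; [apply: divr_ge0; lra|rewrite ler_pdivrMr // mul1r; lra].
lra.
Qed.

Section Cumulative.
Variables (p : R -> R) (b : R).
Hypotheses (b0 : 0 <= b) (p0 : forall x, 0 <= x <= b -> 0 <= p x).
Hypothesis ip : mu.-integrable `[0, b] (EFin \o p).

Lemma Iab_cumul_continuous : {within `[0, b], continuous (Iab p 0)}.
Proof. exact: parameterized_integral_continuous. Qed.

Lemma Iab_cumulB x y : 0 <= x <= y -> y <= b -> Iab p 0 y = Iab p 0 x + Iab p x y.
Proof.
by move=> xy yb; apply: IabD => //; apply: integrable_sub_itv ip.
Qed.

Lemma le_Iab_cumul x y : 0 <= x <= y -> y <= b -> Iab p 0 x <= Iab p 0 y.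
Proof.
move=> xy yb; rewrite (Iab_cumulB xy yb) lerDl; apply: Iab_ge0 => z zxy.
apply: p0; lra.
Qed.

Lemma Iab_cumul0 : Iab p 0 0 = 0.
Proof. by rewrite /Iab set_itv1 Rintegral_set1. Qed.

Hypothesis p1 : Iab p 0 b = 1.

Lemma Iab_cumul_itv x : 0 <= x <= b -> 0 <= Iab p 0 x <= 1.
Proof.
move=> xb; have := @le_Iab_cumul 0 x; have := @le_Iab_cumul x b.
rewrite p1 Iab_cumul0; move=> H1 H2; rewrite H1 ?H2 //; lra.
Qed.

Variables (g : R -> R) (K : R).
Hypothesis gK : forall x y, 0 <= x <= 1 -> 0 <= y <= 1 -> `|g x - g y| <= K * `|x - y|.

Lemma lipschitz_cumul_continuous : {within `[0, b], continuous (fun x => g (Iab p 0 x))}.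
Proof.
apply: (lipschitz_comp_continuous _ _ _ K Iab_cumul_continuous) => x y /=.
by rewrite !in_itv /= => xb yb; apply: gK; exact: Iab_cumul_itv.
Qed.

(** The cumulative function stays in [[0, 1]], where the Lipschitz condition bounds [g] by
    [|g 0| + |K|]. *)
Lemma integrable_lipschitz_cumul (f : R -> R) :
  mu.-integrable `[0, b] (EFin \o f) ->
  mu.-integrable `[0, b] (EFin \o (fun x => g (Iab p 0 x) * f x)).
Proof.
apply: (integrableM_bounded (`|g 0| + `|K|)); first exact: lipschitz_cumul_continuous.
move=> x /Iab_cumul_itv Px.
have := ler_normD (g 0) (g (Iab p 0 x) - g 0).
rewrite addrC subrK => /le_trans; apply; rewrite lerD2l.
apply: (le_trans (gK Px _)); first by rewrite lexx ler01.
rewrite subr0 ger0_norm; last by lra.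
apply: (@le_trans _ _ (`|K| * Iab p 0 x)).
  by rewrite ler_wpM2r ?ler_norm //; lra.
by rewrite ler_piMr //; lra.
Qed.

(* With [P := Iab p 0], [P t = k / n] lets one cut [0, t] into [k] pieces of
   [p]-mass [1 / n], on each of which [P] is within [1 / 2n] of a midpoint. *)
Lemma Iab_cumul_riemann_sum (n : nat) : (0 < n)%N -> forall k, (k <= n)%N ->
  forall t, 0 <= t <= b -> Iab p 0 t = k%:R / n%:R ->
  `|Iab (fun x => g (Iab p 0 x) * p x) 0 t
    - (\sum_(j < k) g ((j%:R + 2^-1) / n%:R)) / n%:R|
  <= k%:R * (`|K| / (2 * n%:R) / n%:R).
Proof.
move=> n0; have nR : 0 < n%:R :> R by rewrite ltr0n.
have int a c : 0 <= a -> c <= b -> mu.-integrable `[a, c] (EFin \o p).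
  by move=> a0 cb; apply: integrable_sub_itv ip.
have igp a c : 0 <= a -> c <= b ->
    mu.-integrable `[a, c] (EFin \o (fun x => g (Iab p 0 x) * p x)).
  by move=> a0 cb; apply: integrable_sub_itv (integrable_lipschitz_cumul ip).
elim=> [_ t tb Pt|k IH kn t tb Pt].
  rewrite big_ord0 mul0r !subr0 mul0r.
  (* When [P t = 0], monotonicity makes [P] vanish on all of [[0, t]], so [g (P x)] is the constant
     [g 0] and the error is zero. *)
  have /= := @Iab_weighted_near_cst (fun x => g (Iab p 0 x)) p 0 t (g 0) 0.
  rewrite Pt !mul0r mulr0 subr0; apply.
  - by apply: int; lra.
  - by apply: igp; lra.
  - by move=> x xt; apply: p0; lra.
  move=> x xt; have := @le_Iab_cumul x t; have := @Iab_cumul_itv x.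
  rewrite Pt mul0r => H1 H2.
  have -> : Iab p 0 x = 0 by apply/eqP; rewrite eq_le H2 ?(andP (H1 _)).1 //; lra.
  by rewrite subrr normr0.
(* [P] is continuous, so the intermediate value theorem provides the previous cut point [s]; the
   remaining piece [[s, t]] has mass [1 / n]. *)
have [s st Ps] : exists2 s, s \in `[0, t] & Iab p 0 s = k%:R / n%:R.
  apply: IVT; first by lra.
    apply: continuous_subspaceW Iab_cumul_continuous.
    by apply: subset_itvl; rewrite bnd_simp; lra.
  rewrite Iab_cumul0 Pt.
  have le : 0 <= k.+1%:R / n%:R :> R by rewrite divr_ge0.
  rewrite (min_idPl le) (max_idPr le) divr_ge0 //=.
  by rewrite ler_pM2r ?invr_gt0 // ler_nat.
move: st; rewrite in_itv /= => st.
have sb : 0 <= s <= b by lra.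
have {}IH := IH (ltnW kn) s sb Ps.
have Pst : Iab p s t = n%:R^-1.
  have := @Iab_cumulB s t st; rewrite Ps Pt => E.
  have {}E : k.+1%:R / n%:R = k%:R / n%:R + Iab p s t by apply: E; lra.
  by apply: (addrI (k%:R / n%:R)); rewrite -E -natr1 mulrDl mul1r.
(* On the last piece [P] is within [1 / 2n] of the midpoint, so [g] deviates by at most [|K| / 2n];
   the mass [1 / n] supplies the second division by [n]. *)
have := @Iab_weighted_near_cst (fun x => g (Iab p 0 x)) p s t
  (g ((k%:R + 2^-1) / n%:R)) (`|K| / (2 * n%:R)).
rewrite Pst => H.
rewrite (@IabD _ _ 0 s t) //; last by apply: igp; lra.
rewrite big_ord_recr /= mulrDl opprD addrACA -[k.+1%:R]natr1 [X in _ <= X]mulrDl mul1r.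
apply: (le_trans (ler_normD _ _)); apply: lerD => //.
apply: H.
- by apply: int; lra.
- by apply: igp; lra.
- by move=> x xt; apply: p0; lra.
move=> x xt.
have k0 : 0 <= k%:R :> R by [].
have kn' : k%:R + 1 <= n%:R :> R by rewrite natr1 ler_nat.
have mid : 0 <= ((k%:R + 2^-1) / n%:R : R) <= 1.
  by apply/andP; split; [apply: divr_ge0; lra|rewrite ler_pdivrMr // mul1r; lra].
have Pxb : 0 <= Iab p 0 x <= 1 by apply: Iab_cumul_itv; lra.
apply: (le_trans (gK Pxb mid)).
apply: (@le_trans _ _ (`|K| * `|Iab p 0 x - (k%:R + 2^-1) / n%:R|)).
  by rewrite ler_wpM2r // ler_norm.
rewrite ler_wpM2l // invfM.
have Psx : k%:R / n%:R <= Iab p 0 x by rewrite -Ps; apply: le_Iab_cumul; lra.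
have Pxt : Iab p 0 x <= k%:R / n%:R + n%:R^-1.
  rewrite -{2}(mul1r n%:R^-1) -mulrDl natr1 -Pt; apply: le_Iab_cumul; lra.
by rewrite mulrDl ler_norml; lra.
Qed.

(** The midpoint sum vanishes for every [n], while the total error over [n] pieces is [|K| / 2n]; an
    integral smaller than every such bound is zero. *)
Lemma Iab_cumul_antisym : (forall x, 0 <= x <= 1 -> g (1 - x) = - g x) ->
  Iab (fun x => g (Iab p 0 x) * p x) 0 b = 0.
Proof.
move=> gN; set I := Iab _ _ _.
have bnd (n : nat) : (0 < n)%N -> `|I| * n%:R <= `|K|.
  move=> n0; have nR : 0 < n%:R :> R by rewrite ltr0n.
  have bb : 0 <= b <= b by rewrite b0 lexx.
  have := @Iab_cumul_riemann_sum n n0 n (leqnn n) b bb.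
  rewrite p1 divff ?gt_eqF // => /(_ erefl).
  rewrite midpoint_sum_antisym // mul0r subr0 -/I mulrCA divff ?gt_eqF // mulr1.
  rewrite invfM mulrA ler_pdivlMr // => /le_trans; apply.
  by rewrite ler_pdivrMr // ler_peMr //; lra.
apply/eqP; rewrite -normr_le0 leNgt; apply/negP => I0.
(* Any integer above [|K| / |I|] contradicts the bound. *)
have := bnd (Num.truncn (`|K| / `|I|)).+1 isT.
rewrite leNgt => /negP; apply.
by rewrite mulrC -ltr_pdivrMr // truncnS_gt.
Qed.

End Cumulative.
End Substitution.

(** * Chords and arcs of the unit circle *)

Section CircleGeometry.
Context {R : realType}.
Implicit Types x y d : R.

Lemma cos_lipschitz x y : `|cos x - cos y| <= `|x - y|.
Proof.
wlog xy : x y / x <= y.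
  by move=> H; case: (leP x y) => [/H//|/ltW/H]; rewrite distrC (distrC y).
have [c _ E] : exists2 c, c \in `[x, y]%R & cos y - cos x = - sin c * (y - x).
  apply: (@MVT_segment R (@cos R) (fun c => - sin c)) => //.
  by apply: continuous_subspaceT; exact: continuous_cos.
by rewrite distrC E normrM normrN (distrC x) ler_piMl // sin_max.
Qed.

Lemma sin_lipschitz x y : `|sin x - sin y| <= `|x - y|.
Proof. by rewrite -!cosBpihalf (le_trans (cos_lipschitz _ _)) // opprB addrA subrK. Qed.

(** With [y = x / 2], the mean value theorem gives [y cos y <= sin y], whence [sin x = 2 sin y cos y
    >= y * 2 cos^2 y = y (1 + cos x) >= y]. *)
Lemma sin_ge_half x : 0 <= x <= pi / 2 -> x / 2 <= sin x.
Proof.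
move=> xb; pose y := x / 2.
have pi0 : 0 < pi :> R by exact: pi_gt0.
have sy : y * cos y <= sin y.
  have y0 : 0 <= y by rewrite /y; lra.
  have [c cy E] : exists2 c, c \in `[0, y]%R & sin y - sin 0 = cos c * (y - 0).
    apply: (@MVT_segment R (@sin R) (@cos R)) => //.
    by apply: continuous_subspaceT; exact: continuous_sin.
  move: cy E; rewrite sin0 !subr0 in_itv /= => cy ->.
  rewrite mulrC ler_wpM2r // leNgt; apply/negP.
  rewrite (@ltr_cos R) ?in_itv /=; try (rewrite /y in cy *; lra).
have cx : 0 <= cos x by apply: cos_ge0_pihalf; rewrite ?in_itv /=; lra.
have cy : 0 <= cos y by apply: cos_ge0_pihalf; rewrite ?in_itv /= /y; lra.
have xE : x = y + y by rewrite /y; lra.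
have c2 : cos x = cos y ^+ 2 *+ 2 - 1 by rewrite xE -mulr2n cos_mulr2n.
have s2 : sin x = (cos y * sin y) *+ 2 by rewrite xE -mulr2n sin_mulr2n.
rewrite s2; have := ler_wpM2l cy sy; nra.
Qed.

(** From [1 - cos d = 2 sin^2 (d / 2)] and [sin (d / 2) >= d / 4] for [0 <= d <= pi]. *)
Lemma cos_le_quadratic d : `|d| <= pi -> d ^+ 2 / 8 <= 1 - cos d.
Proof.
wlog d0 : d / 0 <= d.
  move=> H; case: (leP 0 d) => [/H//|/ltW d0].
  by have := H (- d); rewrite oppr_ge0 normrN sqrrN cosN; exact.
rewrite ger0_norm // => dpi.
have := @sin_ge_half (d / 2); have := cos_mulr2n (d / 2); have := sin2cos2 (d / 2).
have -> : d / 2 *+ 2 = d by rewrite -mulr_natr divfK.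
move=> s2 -> sd; have {}sd : d / 2 / 2 <= sin (d / 2) by apply: sd; lra.
nra.
Qed.

(** The squared chord is [2 - 2 cos (x - y)], which is at least [(x - y)^2 / 4] by the quadratic
    bound. *)
Lemma cexp_dist_ge x y : `|x - y| <= pi ->
  ((`|x - y| / 2) +i* 0) <= `|cexp x - cexp y|.
Proof.
move=> xypi; rewrite normc_def lecR.
have := cos_le_quadratic _ xypi; rewrite cosB => q.
have c1 := cos2Dsin2 x; have c2 := cos2Dsin2 y.
rewrite -[leLHS]ger0_norm ?divr_ge0 // -sqrtr_sqr ler_wsqrtr //=.
rewrite expr_div_n real_normK ?num_real //; nra.
Qed.
End CircleGeometry.

Section Mechanism.
Context {R : realType}.
#[local] Set Implicit Arguments.
#[local] Unset Strict Implicit.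
Notation mu := (@lebesgue_measure R).

(** * Consequences of membership in the class R_L *)

Section IncreasingFunction.
Variables (Rf : R -> R) (LR : R).
Hypothesis RL : in_RL Rf LR.

Lemma in_RL_at1 : Rf 1 = 1.
Proof.
case: RL => _ _ R0 Rs _; have := Rs 0.
by rewrite R0 add0r subr0; apply; rewrite lexx ler01.
Qed.

Lemma in_RL_ge1 : 1 <= LR.
Proof.
case: RL => _ _ R0 _ /(_ 1 0).
by rewrite in_RL_at1 R0 subr0 normr1 mulr1; apply; rewrite ?lexx ?ler01.
Qed.

Lemma RtildeE x : 0 <= x -> Rtilde Rf x = Rf x.
Proof.
rewrite /Rtilde le_eqVlt => /predU1P[<-|x0].
  by rewrite sgr0 mul0r; case: RL.
by rewrite gtr0_sg // mul1r gtr0_norm.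
Qed.

Lemma RtildeN x : Rtilde Rf (- x) = - Rtilde Rf x.
Proof. by rewrite /Rtilde sgrN normrN mulNr. Qed.

Lemma comp_in_RL_lipschitz (u : R -> R) :
  (forall x y, `|u x - u y| <= `|x - y|) ->
  forall x y, 0 <= x <= 1 -> 0 <= y <= 1 ->
    `|u (pi * Rf x) - u (pi * Rf y)| <= pi * LR * `|x - y|.
Proof.
move=> uL x y xb yb; apply: (le_trans (uL _ _)).
rewrite -mulrBr normrM (ger0_norm (pi_ge0 _)) -mulrA.
by apply: ler_wpM2l; [exact: pi_ge0|case: RL => _ _ _ _; apply].
Qed.

(** The symmetry of [Rf] replaces the angle [t] by [pi - t]. This is the antisymmetry to which
    [Iab_cumul_antisym] is applied. *)
Lemma cos_in_RL_antisym x : 0 <= x <= 1 -> cos (pi * Rf (1 - x)) = - cos (pi * Rf x).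
Proof.
case: RL => _ _ _ Rs _ /Rs Rx.
have -> : pi * Rf (1 - x) = - (pi * Rf x) + pi.
  by rewrite (_ : Rf (1 - x) = 1 - Rf x); [ring|lra].
by rewrite cosDpi cosN.
Qed.

End IncreasingFunction.

(** Passes from the mean over [[- pi, pi]] to the mean over [[0, pi]]; [1 + 1] is the factor that
    [Iab_sym] produces for even functions. *)
Lemma mean_sym : (2 * pi)^-1 * (1 + 1) = pi^-1 :> R.
Proof. by rewrite -[1 + 1]/2 invfM mulrAC mulVf ?mul1r // pnatr_eq0. Qed.

(** * The perturbed density, its normalisation and its cumulative function *)

Section Density.
Variable f : R -> R.
Hypothesis fN : forall l, - pi <= l <= pi -> f (- l) = f l.
Hypothesis f0 : forall l, - pi <= l <= pi -> 0 <= f l.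
Hypothesis intf : mu.-integrable `[- pi, pi] (EFin \o f).
Hypothesis If0 : 0 < Iab f 0 pi.

Let pi0 : 0 < @pi R. Proof. exact: pi_gt0. Qed.

Lemma integrable_half : mu.-integrable `[0, pi] (EFin \o f).
Proof.
have pi_pos := pi_gt0 R.
by apply: integrable_sub_itv intf; lra. Qed.

Lemma integrable_normd : mu.-integrable `[0, pi] (EFin \o normd f).
Proof.
apply: eq_integrable (integrableZl _ (Iab f 0 pi)^-1 integrable_half) => //.
by move=> x _; rewrite /= /normd EFinM muleC.
Qed.

Lemma Iab_normd a b : 0 <= a -> b <= pi -> Iab (normd f) a b = Iab f a b / Iab f 0 pi.
Proof.
move=> a0 bpi; rewrite mulrC -IabZ; last exact: (integrable_sub_itv a0 bpi integrable_half).
by apply: eq_Iab => x _; rewrite /normd mulrC.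
Qed.

Lemma Iab_normd1 : Iab (normd f) 0 pi = 1.
Proof. by rewrite Iab_normd // divff // gt_eqF. Qed.

Variable Delta : R.
Hypothesis Delta0 : 0 < Delta.

#[clearbody] Let D0 : 0 < 1 + pi * Delta.
Proof. by rewrite addr_gt0 // mulr_gt0. Qed.

Lemma Iab_normd_shift a b : 0 <= a -> a <= b -> b <= pi ->
  mu.-integrable `[a, b] (EFin \o (fun x => (normd f x + Delta) / (1 + pi * Delta))) /\
  Iab (fun x => (normd f x + Delta) / (1 + pi * Delta)) a b =
    (Iab (normd f) a b + Delta * (b - a)) / (1 + pi * Delta).
Proof.
move=> a0 ab bpi; have int := integrable_sub_itv a0 bpi integrable_normd.
have int2 : mu.-integrable `[a, b] (EFin \o (fun x => normd f x + Delta)).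
  exact: (integrableD _ int (integrable_cst_itv _ _ _)).
split.
  apply: eq_integrable (integrableZl _ (1 + pi * Delta)^-1 int2) => //.
  by move=> x _; rewrite /= EFinM muleC.
rewrite -(Iab_cst _ _ Delta ab) /Iab -RintegralD //; last exact: integrable_cst_itv.
by rewrite -RintegralZr.
Qed.

(** The quotient [(f~ + Delta) / (1 + pi * Delta)] already has integral 1, so normalising only
    cancels the mean of [f]. *)
Lemma normd_hfun x : normd (hfun f Delta) x = (normd f x + Delta) / (1 + pi * Delta).
Proof.
have hE y : hfun f Delta y = (pi^-1 * Iab f 0 pi) * ((normd f y + Delta) / (1 + pi * Delta)).
  by rewrite /hfun mulrAC mulrA.
have [int E] := Iab_normd_shift (lexx 0) (pi_ge0 R) (lexx pi).
rewrite /normd (eq_Iab (fun y _ => hE y)) IabZ // hE E Iab_normd1 subr0 (mulrC Delta).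
rewrite divff ?gt_eqF // mulr1 -/(normd f x) mulrC mulKf //.
by rewrite mulf_neq0 // ?invr_eq0 gt_eqF.
Qed.

Lemma integrable_normd_hfun : mu.-integrable `[0, pi] (EFin \o normd (hfun f Delta)).
Proof.
have [int _] := Iab_normd_shift (lexx 0) (pi_ge0 R) (lexx pi).
by apply: eq_integrable int => // x _; rewrite /= normd_hfun.
Qed.

Lemma normd_ge0 x : 0 <= x <= pi -> 0 <= normd f x.
Proof.
have pi_pos := pi_gt0 R.
by move=> xb; apply: divr_ge0; [apply: f0; lra|exact: ltW]. Qed.

Lemma normd_hfun_ge0 x : 0 <= x <= pi -> 0 <= normd (hfun f Delta) x.
Proof.
by move=> /normd_ge0 xb; rewrite normd_hfun; apply: divr_ge0; [rewrite addr_ge0 // ltW|exact: ltW].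
Qed.

Lemma cumul_hfunE l : 0 <= l <= pi ->
  cumul (hfun f Delta) l = (cumul f l + Delta * l) / (1 + pi * Delta).
Proof.
have pi_pos := pi_gt0 R.
move=> lb; rewrite /cumul /I0 (andP lb).1 (eq_Iab (fun y _ => normd_hfun y)).
have [|||_ ->] := @Iab_normd_shift 0 l; rewrite ?subr0 //; lra.
Qed.

Lemma Iab_normd_hfun1 : Iab (normd (hfun f Delta)) 0 pi = 1.
Proof.
have pi_pos := pi_gt0 R.
have := @cumul_hfunE pi; rewrite /cumul /I0 pi_ge0 Iab_normd1 => ->; last by lra.
by rewrite (mulrC Delta) divff // gt_eqF.
Qed.

Lemma cumul_hfunN x : 0 <= x <= pi ->
  cumul (hfun f Delta) (- x) = - Iab (normd (hfun f Delta)) 0 x.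
Proof.
have pi_pos := pi_gt0 R.
(* At [x = 0] the oriented integral takes its nonnegative branch, so that point is treated apart. *)
move=> xb; rewrite /cumul /I0; case: ifPn => [|_].
  rewrite oppr_ge0 => x0; have -> : x = 0 by lra.
  by rewrite oppr0 Iab_cumul0 oppr0.
have ix : mu.-integrable `[0, x] (EFin \o normd (hfun f Delta)).
  by apply: integrable_sub_itv integrable_normd_hfun; lra.
have [_ <-] := Iab_opp ix; congr (- _); apply: eq_Iab => y yb.
by rewrite !normd_hfun /normd fN //; lra.
Qed.

(** * The pairings in the privacy measure and the privacy bound *)

Variables (Rf : R -> R) (LR : R).
Hypothesis RL : in_RL Rf LR.

Let H : R -> R := Iab (normd (hfun f Delta)) 0.

#[clearbody] Let H01 x : 0 <= x <= pi -> 0 <= H x <= 1.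
Proof.
exact: (Iab_cumul_itv normd_hfun_ge0 integrable_normd_hfun Iab_normd_hfun1).
Qed.

Lemma Psi_mechE x : 0 <= x <= pi ->
  Psi_mech Rf (hfun f Delta) x = cexp (pi * Rf (H x)).
Proof.
move=> xb; rewrite /Psi_mech /cumul /I0 (andP xb).1 (RtildeE RL) //.
by case/andP: (H01 xb).
Qed.

Lemma Psi_mechN x : 0 <= x <= pi ->
  Psi_mech Rf (hfun f Delta) (- x) = cexp (- (pi * Rf (H x))).
Proof.
move=> xb; rewrite /Psi_mech cumul_hfunN // RtildeN (RtildeE RL) ?mulrN //.
by case/andP: (H01 xb).
Qed.

(** The angle is odd and [f] is even: the cosine part doubles and the sine part cancels. *)
Lemma pairing_Psi :
  pairing (Psi_mech Rf (hfun f Delta)) f =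
  (pi^-1 * Iab (fun x => cos (pi * Rf (H x)) * f x) 0 pi) +i* 0.
Proof.
have pi_pos := pi_gt0 R.
have intu (u : R -> R) : (forall x y, `|u x - u y| <= `|x - y|) ->
    mu.-integrable `[0, pi] (EFin \o (fun x => u (pi * Rf (H x)) * f x)).
  move=> uL; apply: (integrable_lipschitz_cumul (pi_ge0 R) normd_hfun_ge0
    integrable_normd_hfun Iab_normd_hfun1 (comp_in_RL_lipschitz RL uL)).
  exact: integrable_half.
have ic := intu _ (@cos_lipschitz R); have iS := intu _ (@sin_lipschitz R).
have eqi (u v : R -> R) : (forall x, 0 <= x <= pi -> u x = v x) ->
    mu.-integrable `[0, pi] (EFin \o u) -> mu.-integrable `[0, pi] (EFin \o v).
  by move=> uv; apply: eq_integrable => // x; rewrite inE /= in_itv /= => /uv ->.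
have rE x : 0 <= x <= pi -> cos (pi * Rf (H x)) * f x =
    complex.Re (Psi_mech Rf (hfun f Delta) x) * f x.
  by move=> xb; rewrite Psi_mechE.
have iE x : 0 <= x <= pi -> sin (pi * Rf (H x)) * f x =
    complex.Im (Psi_mech Rf (hfun f Delta) x) * f x.
  by move=> xb; rewrite Psi_mechE.
rewrite /pairing (@Iab_sym _ _ _ 1) ?pi_ge0 //; first last.
- by move=> x xb; rewrite mul1r Psi_mechN // Psi_mechE // fN /= ?cosN //; lra.
- exact: eqi rE ic.
rewrite (@Iab_sym _ _ _ (-1)) ?pi_ge0 //; first last.
- by move=> x xb; rewrite mulN1r Psi_mechN // Psi_mechE // fN /= ?sinN ?mulNr //; lra.
- exact: eqi iE iS.
rewrite subrr mul0r mulr0 -(eq_Iab rE) mulrA mean_sym.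
by [].
Qed.

Lemma cmeanE : cmean f = (pi^-1 * Iab f 0 pi) +i* 0.
Proof.
have pi_pos := pi_gt0 R.
rewrite /cmean /pairing /=.
rewrite (@Iab_sym _ (fun x => 1 * f x) _ 1) ?pi_ge0 //; first last.
- by move=> x xb; rewrite !mul1r fN //; lra.
- apply: eq_integrable integrable_half => // x _; by rewrite /= mul1r.
rewrite (@eq_Iab _ (fun x => 1 * f x) f); last by move=> x _; rewrite mul1r.
rewrite (@eq_Iab _ (fun x => 0 * f x) (fun=> 0)); last by move=> x _; rewrite mul0r.
rewrite Iab_cst ?mul0r ?mulr0; last by lra.
by rewrite mulrA mean_sym.
Qed.

(** The filter has modulus 1 because [cos^2 + sin^2 = 1]. *)
Lemma pairing_allpass (g : R -> R) :
  pairing (fun x => Psi_mech Rf g x * (Psi_mech Rf g x)^*) f = cmean f.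
Proof.
rewrite /cmean; congr (pairing _ _); apply/funext => x.
by rewrite /Psi_mech /cexp -normCK normc_def /= cos2Dsin2 sqrtr1 expr1n.
Qed.

Lemma Iab_cos_hfun_le (S : R) : (forall x, 0 <= x <= pi -> `|pi * normd f x - 1| <= S) ->
  `|Iab (fun x => cos (pi * Rf (H x)) * f x) 0 pi|
  <= (Delta * pi / (1 + pi * Delta) * S) * Iab f 0 pi.
Proof.
move=> fS; have pi_pos := pi_gt0 R.
have cL := comp_in_RL_lipschitz RL (@cos_lipschitz R).
have int := integrable_lipschitz_cumul (pi_ge0 R) normd_hfun_ge0
  integrable_normd_hfun Iab_normd_hfun1 cL.
have J0 := Iab_cumul_antisym (pi_ge0 R) normd_hfun_ge0
  integrable_normd_hfun Iab_normd_hfun1 cL (cos_in_RL_antisym RL).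
have -> : Iab (fun x => cos (pi * Rf (H x)) * f x) 0 pi =
    Iab (fun x => cos (pi * Rf (H x)) * normd f x) 0 pi * Iab f 0 pi.
  rewrite mulrC -(IabZ _ (int _ integrable_normd)); apply: eq_Iab => x _.
  by rewrite mulrCA; congr (_ * _); rewrite /normd mulrC divfK // gt_eqF.
rewrite normrM (gtr0_norm If0); apply: ler_wpM2r; first exact: ltW.
(* The integral [J0] against the density [h~] is zero, so it can be subtracted and only [f~ - h~]
   has to be estimated. *)
rewrite -[X in `|X|]subr0 -[X in _ - X]J0 /Iab -RintegralB //.
- have -> : Delta * pi / (1 + pi * Delta) * S = Iab (fun=> Delta / (1 + pi * Delta) * S) 0 pi.
    by rewrite Iab_cst ?pi_ge0 // subr0 mulrAC; ring.
  apply: le_norm_Iab; [|exact: integrable_cst_itv|].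
    exact: (integrableB _ (int _ integrable_normd) (int _ integrable_normd_hfun)).
  move=> x xb; rewrite -mulrBr normrM -[leRHS]mul1r; apply: ler_pM => //.
    exact: cos_max.
  have -> : normd f x - normd (hfun f Delta) x =
      Delta / (1 + pi * Delta) * (pi * normd f x - 1).
    rewrite normd_hfun; move: D0; move: (normd f x) (@pi R) => n q D1.
    by field; rewrite gt_eqF.
  have D1 : 0 <= Delta / (1 + pi * Delta) by rewrite divr_ge0 // ltW.
  by rewrite normrM (ger0_norm D1) ler_wpM2l // fS.
- exact: int integrable_normd.
- exact: int integrable_normd_hfun.
Qed.

Lemma hfun_deltaLIP delta : 0 < delta ->
  ((Num.sqrt delta / (LR * pi))%:E < Ssup f)%E ->
  Delta <= Bconst f LR delta ->
  is_deltaLIP delta (Psi_mech Rf (hfun f Delta)) f.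
Proof.
have pi_pos := pi_gt0 R; have Dpos := Delta0; have D1 := D0; have L1 := in_RL_ge1 RL.
move=> delta0; rewrite /Bconst.
(* An infinite supremum gives [Bconst] its default value 0, which excludes a positive [Delta]. *)
case ES : (Ssup f) => [S| |] //; last by rewrite leNgt Delta0.
rewrite lte_fin => sS DB.
have fS x : 0 <= x <= pi -> `|pi * normd f x - 1| <= S.
  move=> xb; rewrite -lee_fin -ES; apply: ereal_sup_ubound.
  by exists x => //=; rewrite in_itv.
have JE := Iab_cos_hfun_le fS.
rewrite /is_deltaLIP /LIP pairing_allpass pairing_Psi cmeanE.
set I := Iab f 0 pi in JE *; set J := Iab _ 0 pi in JE *.
have Ipos : 0 < I := If0.
have key : Delta * pi / (1 + pi * Delta) * S <= Num.sqrt delta.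
  have LRpi : 0 < LR * pi by rewrite mulr_gt0 //; lra.
  rewrite ltr_pdivrMr // in sS.
  have s0 : 0 <= Num.sqrt delta by exact: sqrtr_ge0.
  (* The hypothesis on the supremum is exactly positivity of the denominator of [Bconst]; clearing
     it gives [Delta * LR * pi^2 * S <= sqrt delta * (1 + pi * Delta)]. *)
  have den : 0 < LR * pi ^+ 2 * S - pi * Num.sqrt delta.
    have -> : LR * pi ^+ 2 * S - pi * Num.sqrt delta =
      pi * (S * (LR * pi) - Num.sqrt delta) by ring.
    by rewrite mulr_gt0 // subr_gt0.
  rewrite ler_pdivlMr // in DB.
  rewrite mulrAC ler_pdivrMr //.
  have S0 : 0 <= S.
    by apply: le_trans (fS 0 _); [exact: normr_ge0|rewrite lexx ltW].
  (* The extra factor [LR * pi] is at least 1, since [LR >= 1] and [pi >= 2]. *)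
  apply: (@le_trans _ _ (Delta * pi * S * (LR * pi))).
    rewrite ler_peMr //; first by rewrite !mulr_ge0 // ltW.
    have : 2 <= @pi R by exact: pi_ge2.
    nra.
  by move: DB; lra.
have JI : `|J / I| <= Num.sqrt delta.
  by rewrite normrM normfV (gtr0_norm Ipos) ler_pdivrMr // (le_trans JE) // ler_wpM2r // ltW.
have -> : (pi^-1 * J +i* 0) ^+ 2 / ((pi^-1 * I +i* 0) * (pi^-1 * I +i* 0)) =
    (((J / I) ^+ 2)%:C : R[i]).
  have nz : (I%:C : R[i]) != 0 by rewrite (inj_eq (@complexI R)) gt_eqF.
  have pnz : (pi%:C : R[i]) != 0 by rewrite (inj_eq (@complexI R)) gt_eqF.
  have frac (a b c : R[i]) : a != 0 -> b != 0 ->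
      (a^-1 * c) ^+ 2 / (a^-1 * b * (a^-1 * b)) = (c / b) ^+ 2.
    by move=> a0 b0; field; rewrite a0 b0.
  by rewrite !complexr0 !rmorphXn !rmorphM /= !fmorphV frac.
rewrite -(rmorph1 (real_complex R)) -rmorphB lecR lerD2l lerN2.
rewrite -[leRHS](sqr_sqrtr (ltW delta0)) -(real_normK (num_real (J / I))).
by rewrite ler_sqr ?nnegrE.
Qed.

End Density.
End Mechanism.

(** * The pointwise lower bound, for a positive density *)

Lemma cumul_lt1 (R : realType) (f : R -> R) (l : R) :
  (forall x, 0 <= x <= pi -> 0 < f x) ->
  (@lebesgue_measure R).-integrable `[- pi, pi] (EFin \o f) ->
  0 < l < pi -> 0 < cumul f l < 1.
Proof.
move=> fpos int lb; have intf := integrable_half int.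
have i0 : (@lebesgue_measure R).-integrable `[0, l] (EFin \o f).
  by apply: integrable_sub_itv intf; lra.
have il : (@lebesgue_measure R).-integrable `[l, pi] (EFin \o f).
  by apply: integrable_sub_itv intf; lra.
(* Both [[0, l]] and [[l, pi]] carry positive mass, which keeps [F l] inside the open interval where
   [Rf] is differentiable. *)
have F0 : 0 < Iab f 0 l by apply: Iab_gt0 => // [|x xb]; [|apply: fpos]; lra.
have F1 : 0 < Iab f l pi by apply: Iab_gt0 => // [|x xb]; [|apply: fpos]; lra.
have E : Iab f 0 pi = Iab f 0 l + Iab f l pi by apply: IabD => //; lra.
have Ipos : 0 < Iab f 0 pi by rewrite E addr_gt0.
rewrite /cumul /I0 ifT; last by lra.
rewrite (Iab_normd int) //; last by lra.
by rewrite divr_gt0 //= ltr_pdivrMr // mul1r E ltrDl.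
Qed.

(** The mean value theorem writes the increment as [r c * (b - a)] with [c] on the segment, and
    [r c] is at least the infimum. *)
Lemma Qmin_le_increment (R : realType) (Rf r : R -> R) (a b : R) :
  (forall x : R, 0 < x < 1 -> @is_derive R R R x 1 Rf (r x) /\ 0 < r x) ->
  0 < a < 1 -> 0 < b < 1 ->
  Qmin r a b * `|a - b| <= `|Rf a - Rf b|.
Proof.
move=> Rr.
wlog ab : a b / a <= b.
  move=> H a01 b01; case: (leP a b) => [/H|/ltW/H]; first exact.
  rewrite distrC (distrC (Rf b)) /Qmin minC maxC; exact.
move=> a01 b01; rewrite /Qmin (min_idPl ab) (max_idPr ab).
have der x : a <= x <= b -> @is_derive R R R x 1 Rf (r x) /\ 0 < r x.
  by move=> xab; apply: Rr; lra.
have [c cab E] : exists2 c, c \in `[a, b]%R & Rf b - Rf a = r c * (b - a).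
  apply: MVT_segment => //.
    by move=> x; rewrite in_itv /= => xab; apply: (der x _).1; lra.
  apply: derivable_within_continuous => x; rewrite in_itv /= => /der[dx _].
  exact: ex_derive.
rewrite in_itv /= in cab.
rewrite distrC (distrC (Rf a)) E normrM (gtr0_norm (der c cab).2).
apply: ler_wpM2r => //; apply: ge_inf; last by exists c.
(* An infimum lies below the elements of a set only if the set is bounded below; positivity of [r]
   provides the bound 0. *)
by exists 0 => _ [x /der[_ /ltW rx] <-].
Qed.

Theorem theorem3 (R : realType) (f : R -> R) (Rf : R -> R) (LR delta : R) :
  (* f: residual spectral density, an even nonnegative integrable function on [-pi,pi] *)
  (forall l, - pi <= l <= pi -> f (- l) = f l) ->
  (forall l, - pi <= l <= pi -> 0 <= f l) ->
  (@lebesgue_measure R).-integrable `[- pi, pi] (EFin \o f) ->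
  0 < Iab f 0 pi ->
  in_RL Rf LR ->
  0 < delta ->
  ((Num.sqrt delta / (LR * pi))%:E < Ssup f)%E ->
  (forall Delta, 0 < Delta <= Bconst f LR delta ->
     is_deltaLIP delta (Psi_mech Rf (hfun f Delta)) f)
  /\
  (forall r : R -> R,
     (forall x : R, 0 < x < 1 -> @is_derive R R R x 1 Rf (r x) /\ 0 < r x) ->
     (forall l, 0 <= l <= pi -> 0 < f l) ->
     forall Delta, 0 < Delta ->
     forall l, 0 < l < pi ->
       let alpha := Delta * pi / (1 + Delta * pi) in
       let F := cumul f in
       ((alpha * pi / 2 * Qmin r (F l) ((1 - alpha) * F l + alpha * (l / pi))
           * `|F l - l / pi|) +i* 0)
       <= `| Psi_mech Rf (hfun f Delta) l - Psi_mech Rf f l |).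
Proof.
move=> fN f0 intf If0 RL delta0 sS; split.
  by move=> Delta /andP[D0 DB]; exact: (hfun_deltaLIP fN f0 intf If0 D0 RL delta0 sS).
move=> r Rr fpos Delta D0 l lb; cbv zeta.
set F := cumul f; set alpha := Delta * pi / (1 + Delta * pi).
have pi0 := pi_gt0 R.
have F01 : 0 < F l < 1 by exact: cumul_lt1 lb.
have D1 : 0 < 1 + Delta * pi by rewrite addr_gt0 // mulr_gt0.
have a01 : 0 < alpha < 1.
  rewrite /alpha divr_gt0 ?mulr_gt0 //= ltr_pdivrMr // mul1r; lra.
have lpi : 0 < l / pi < 1.
  rewrite divr_gt0 //=; last by lra.
  by rewrite ltr_pdivrMr // mul1r; lra.
(* The perturbed cumulative function at [l] is the second endpoint of the segment over which [Qmin]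
   is taken. *)
have HE : cumul (hfun f Delta) l = (1 - alpha) * F l + alpha * (l / pi).
  rewrite (cumul_hfunE intf If0 D0) -/F; last by lra.
  rewrite /alpha; move: D1 pi0 {lpi a01 lb alpha}; move: (F l) (@pi R) => n q D1 q0.
  by field; rewrite !gt_eqF // mulrC.
set Hl := (1 - alpha) * F l + alpha * (l / pi) in HE *.
have H01 : 0 < Hl < 1 by rewrite /Hl; apply/andP; split; nra.
have Rb x : 0 < x < 1 -> 0 <= Rf x <= 1.
  by move=> x01; case: RL => _ Rb _ _ _; apply: Rb; lra.
rewrite /Psi_mech HE -/F (RtildeE RL) ?(ltW (andP H01).1) //.
rewrite (RtildeE RL) ?(ltW (andP F01).1) //.
have RF := Rb _ F01; have RH := Rb _ H01.
(* Both values of [Rf] lie in [[0, 1]], so the arc is at most [pi] and the chord is at least half of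
   it. *)
apply: (@le_trans _ _ ((`|pi * Rf Hl - pi * Rf (F l)| / 2) +i* 0)); last first.
  apply: cexp_dist_ge; rewrite -mulrBr normrM gtr0_norm // ler_piMr ?pi_ge0 //.
  by rewrite ler_norml; lra.
rewrite lecR -mulrBr normrM (gtr0_norm pi0) (distrC (Rf Hl)).
have := Qmin_le_increment _ _ _ _ _ Rr F01 H01.
(* This identity is the source of the factor [alpha] in the bound. *)
have -> : F l - Hl = alpha * (F l - l / pi) by rewrite /Hl; ring.
rewrite normrM (gtr0_norm (andP a01).1) => Q.
rewrite (_ : _ / 2 * _ * _ = pi * (Qmin r (F l) Hl * (alpha * `|F l - l / pi|)) / 2); last first.
  by ring.
by rewrite ler_pM2r // ler_wpM2l // ltW.
Qed.
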